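(* For all integers $n\ge 0$, \[ a_{2,4}(27n)\equiv a_{2,4}(3n) \pmod 3. \]
   Context: For positive integers $r,s$, $a_{r,s}(n)$ denotes the number of multicolored partitions of $n$ in which each even part may appear in one of $r$ colors and each odd part may appear in one of $s$ colors (copies of the same part size in different colors are distinct), with $a_{r,s}(0)=1$. Equivalently, for $|q|<1$, $\sum_{n\ge0}a_{r,s}(n)q^n = f_2^{s-r}/f_1^{s}$, where $f_m=\prod_{i\ge1}(1-q^{mi})$. In particular $\sum_{n\ge0}a_{2,4}(n)q^n=f_2^2/f_1^4$. *)

(* Defs.v *)
From HB Require Import structures.
From mathcomp Require Import all_boot.

Set Implicit Arguments.
Unset Strict Implicit.
Unset Printing Implicit Defensive.

Definition ncolors (r s k : nat) : nat := if odd k then s else r.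

(* The coloured parts of size at most n; the tag i : 'I_n stands for the part
   size i.+1, so that sizes range over 1, ..., n. *)
Definition cpart (r s n : nat) : finType :=
  {i : 'I_n & 'I_(ncolors r s i.+1)}.

Definition cpart_size (r s n : nat) (p : cpart r s n) : nat := (tag p).+1.

(* A multicoloured partition of n is a finite multiset of coloured parts whose
   sizes sum to n; it is encoded by its multiplicity function. Part sizes and
   multiplicities in a partition of n never exceed n, so the bounds built into
   cpart r s n and 'I_n.+1 lose nothing. *)
Definition cpartitions (r s n : nat) : {set {ffun cpart r s n -> 'I_n.+1}} :=
  [set m : {ffun cpart r s n -> 'I_n.+1} |
    \sum_(p : cpart r s n) cpart_size p * m p == n].

Definition a (r s n : nat) : nat := #|cpartitions r s n|.

(* Main.v *)
(** Let phi = sum_(s in Z) (-1)^s q^(s^2).  Gauss' identity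
    phi = prod_k (1 - q^k) / (1 + q^k) says that the generating function
    f_2^2 / f_1^4 of a_{2,4} is 1 / phi^2.  Modulo 3 this is phi / phi^3 =
    phi(q) / phi(q^3).  A square divisible by 3 is 9 times a square, so keeping
    the exponents divisible by 3 gives
    sum_n a_{2,4}(3n) q^n = phi(q^3) / phi(q) = phi^2 modulo 3.  Finally, the
    coefficients of phi^2 at 9n and at n agree, because x^2 + y^2 = 0 modulo 3
    forces x = y = 0 modulo 3.

    Gauss' identity comes from a finite form in the style of Shanks; power
    series are handled as polynomials modulo 'X^m. *)
Require Import Defs.
From mathcomp Require Import all_boot.
From mathcomp Require Import all_algebra ring zify.

Set Implicit Arguments.
Unset Strict Implicit.
Unset Printing Implicit Defensive.
Import GRing.Theory.
Local Open Scope ring_scope.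

(** * Finite form of Gauss' identity *)

Section Gauss.
Variables (R : comNzRingType) (q : R).

(** Truncation of phi to |s| <= n; the terms s and -s are merged, hence the factor 2. *)
Definition theta_sum n : R :=
  1 + \sum_(0 <= t < n) 2 * (-1) ^+ t.+1 * q ^+ (t.+1 ^ 2).
Definition minus_prod m n : R := \prod_(m <= k < n) (1 - q ^+ k.+1).
Definition plus_prod n : R := \prod_(0 <= k < n) (1 + q ^+ k.+1).
Definition gauss_rem n : R :=
  \sum_(0 <= t < n) 2 * (-1) ^+ t.+1 * q ^+ (t.+1 * n.+1)
                      * minus_prod t.+1 n * plus_prod t.

Lemma minus_prod_recl m n : (m < n)%N ->
  minus_prod m n = (1 - q ^+ m.+1) * minus_prod m.+1 n.
Proof. by move=> mn; rewrite /minus_prod big_ltn. Qed.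

Lemma minus_prod_recr m n : (m <= n)%N ->
  minus_prod m n.+1 = minus_prod m n * (1 - q ^+ n.+1).
Proof. by move=> mn; rewrite /minus_prod big_nat_recr. Qed.

Lemma plus_prodS n : plus_prod n.+1 = plus_prod n * (1 + q ^+ n.+1).
Proof. by rewrite /plus_prod big_nat_recr. Qed.

(* Up to sign, the summands of the left-hand side are the increments of v. *)
Lemma gauss_remS n : gauss_rem n.+1 - (1 + q ^+ n.+1) * gauss_rem n =
  2 * q ^+ n.+1 * minus_prod 0 n
  + 2 * (-1) ^+ n.+1 * q ^+ (n.+1 ^ 2) * plus_prod n.+1.
Proof.
pose v t := 2 * (-1) ^+ t * q ^+ (t.+1 * n.+1) * minus_prod t n * plus_prod t.
have step t : (0 <= t < n)%N ->
    2 * (-1) ^+ t.+1 * q ^+ (t.+1 * n.+2) * minus_prod t.+1 n.+1 * plus_prod t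
    - (1 + q ^+ n.+1)
      * (2 * (-1) ^+ t.+1 * q ^+ (t.+1 * n.+1) * minus_prod t.+1 n * plus_prod t)
    = - (v t.+1 - v t).
  move=> /andP[_ tn]; rewrite /v minus_prod_recr // (minus_prod_recl tn) plus_prodS.
  rewrite (_ : t.+1 * n.+2 = t.+1 * n.+1 + t.+1)%N; last by lia.
  rewrite (_ : t.+2 * n.+1 = t.+1 * n.+1 + n.+1)%N; last by lia.
  rewrite !exprD !(exprS (-1)).
  by ring.
(* The summand t = n of [gauss_rem n.+1] has no partner and is split off. The rest telescopes to
   [v 0 - v n], and [v n] with that summand yields the last factor of [plus_prod n.+1]. *)
rewrite /gauss_rem big_nat_recr //= mulr_sumr addrAC -sumrB (eq_big_nat _ _ step).
rewrite sumrN telescope_sumr // /v plus_prodS.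
rewrite (_ : n.+1 ^ 2 = n.+1 * n.+1)%N; last by lia.
rewrite (_ : n.+1 * n.+2 = n.+1 * n.+1 + n.+1)%N; last by lia.
have -> : minus_prod n n = 1 by rewrite /minus_prod big_geq.
have -> : minus_prod n.+1 n.+1 = 1 by rewrite /minus_prod big_geq.
have -> : plus_prod 0 = 1 by rewrite /plus_prod big_geq.
rewrite !exprD mul1n !(exprS (-1)) expr0.
by ring.
Qed.

(* Since gauss_rem n is a multiple of q^(n+1), this is Gauss' identity modulo
   q^(n+1); the denominators prod_k (1 + q^k) have been cleared. *)
Lemma gauss_finite n :
  theta_sum n * plus_prod n = minus_prod 0 n + gauss_rem n.
Proof.
elim: n => [|n IHn].
  by rewrite /theta_sum /plus_prod /minus_prod /gauss_rem !big_geq // !addr0 mulr1.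
have -> : theta_sum n.+1 = theta_sum n + 2 * (-1) ^+ n.+1 * q ^+ (n.+1 ^ 2).
  by rewrite /theta_sum big_nat_recr //= addrA.
rewrite mulrDl {1}plus_prodS mulrA IHn minus_prod_recr //.
have /eqP := gauss_remS n; rewrite subr_eq => /eqP ->.
by ring.
Qed.

End Gauss.

(** * Power series modulo X^m *)

Section Truncation.
Variable F : fieldType.
Implicit Types p q u : {poly F}.

Definition eqX m p q := 'X^m %| p - q.

Lemma eqXx m p : eqX m p p. Proof. by rewrite /eqX subrr dvdp0. Qed.

Lemma eqX_sym m p q : eqX m p q -> eqX m q p.
Proof. by rewrite /eqX -opprB dvdpNr. Qed.

Lemma eqX_trans m q p (r : {poly F}) : eqX m p q -> eqX m q r -> eqX m p r.
Proof. by move=> pq qr; rewrite /eqX -(subrKA q) dvdp_add. Qed.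

Lemma eqXM m p q p' q' : eqX m p q -> eqX m p' q' -> eqX m (p * p') (q * q').
Proof.
move=> pq pq'; rewrite /eqX (_ : _ - _ = (p - q) * p' + q * (p' - q')); last by ring.
by apply: dvdp_add; [apply: dvdp_mulr | apply: dvdp_mull].
Qed.

Lemma eqX_exp m p q k : eqX m p q -> eqX m (p ^+ k) (q ^+ k).
Proof. by move=> pq; elim: k => [|k IHk]; rewrite ?eqXx // !exprS eqXM. Qed.

Lemma eqX_leq m n p q : (m <= n)%N -> eqX n p q -> eqX m p q.
Proof. by move=> mn; apply: dvdp_trans; rewrite dvdp_exp2l. Qed.

Lemma eqXP m p q : reflect (forall i, (i < m)%N -> p`_i = q`_i) (eqX m p q).
Proof.
apply: (iffP idP) => [/dvdpP[r pq] i im | pq].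
  by apply/eqP; rewrite -subr_eq0 -coefB pq coefMXn im.
apply/dvdpP; exists (drop_poly m (p - q)).
rewrite -[LHS](poly_take_drop m) [take_poly _ _](_ : _ = 0) ?add0r //.
apply/polyP=> i; rewrite coef_take_poly coef0; case: ltnP => // /pq.
by rewrite coefB => ->; rewrite subrr.
Qed.

(** A nonzero constant term makes [u] coprime to X^m. *)
Lemma eqX_cancel m u p q : u`_0 != 0 -> eqX m (u * p) (u * q) -> eqX m p q.
Proof.
move=> u0; rewrite /eqX -mulrBr Gauss_dvdpr // coprimep_expl //.
by rewrite coprimep_sym coprimepX rootE horner_coef0.
Qed.

Lemma eqX_addXn m k p q : (m <= k)%N -> eqX m (p + 'X^k * q) p.
Proof. by move=> mk; rewrite /eqX addrC addKr dvdp_mulr // dvdp_exp2l. Qed.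

Lemma eqX_prod1 m (I : Type) (s : seq I) (P : pred I) (f : I -> {poly F}) :
  (forall i, P i -> eqX m (f i) 1) -> eqX m (\prod_(i <- s | P i) f i) 1.
Proof.
move=> f1; elim/big_rec: _ => [|i p Pi p1]; first exact: eqXx.
by rewrite -[1]mul1r eqXM ?f1.
Qed.

Lemma eqX_prod_nat m n M (f : nat -> {poly F}) : (n <= M)%N ->
  (forall k, (n <= k)%N -> eqX m (f k) 1) ->
  eqX m (\prod_(0 <= k < M) f k) (\prod_(0 <= k < n) f k).
Proof.
move=> nM f1; rewrite (big_cat_nat (leq0n n) nM) /= -[X in eqX _ _ X]mulr1.
rewrite eqXM ?eqXx // big_nat_cond eqX_prod1 // => k /andP[/andP[/f1]] //.
Qed.

Lemma eqX_1BXn m k : (m <= k)%N -> eqX m (1 - 'X^k : {poly F}) 1.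
Proof. by move=> mk; rewrite -['X^k]mulr1 -mulrN eqX_addXn. Qed.

Lemma coef0_1BXn k : (1 - 'X^(k.+1) : {poly F})`_0 = 1.
Proof. by rewrite coefB coef1 coefXn subr0. Qed.

Lemma coef0_prod (I : Type) (s : seq I) (P : pred I) (f : I -> {poly F}) :
  (\prod_(i <- s | P i) f i)`_0 = \prod_(i <- s | P i) (f i)`_0.
Proof.
by rewrite -!horner_coef0 horner_prod; under eq_bigr do rewrite horner_coef0.
Qed.

(** * Generating function of coloured partitions *)

Definition cpart_den r s n : {poly F} :=
  \prod_(0 <= k < n) (1 - 'X^(k.+1)) ^+ ncolors r s k.+1.

(** The geometric sums stop at [n] to match the bound on multiplicities in [cpartitions]. *)
Definition cpart_gf r s n : {poly F} :=
  \prod_(0 <= k < n) (\sum_(j < n.+1) 'X^(k.+1 * j)) ^+ ncolors r s k.+1.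

(** Distributing the product over the sums gives one monomial per multiplicity function, with the
    total size as exponent. *)
Lemma coef_cpart_gf_diag r s n : (cpart_gf r s n)`_n = (a r s n)%:R.
Proof.
rewrite /cpart_gf big_mkord.
have -> : \prod_(i < n) (\sum_(j < n.+1) 'X^(i.+1 * j)) ^+ ncolors r s i.+1 =
  \prod_(p : cpart r s n) \sum_(j < n.+1) 'X^(cpart_size p * j) :> {poly F}.
  rewrite -(sig_big_dep xpredT (fun=> xpredT)
    (fun (i : 'I_n) (c : 'I_(ncolors r s i.+1)) =>
       \sum_(j < n.+1) 'X^(i.+1 * j) : {poly F})) /=.
  by apply: eq_bigr => i _; rewrite prodr_const card_ord.
rewrite bigA_distr_bigA coef_sum /a -sum1_card natr_sum [RHS]big_mkcond /=.
apply: eq_bigr => m _; rewrite -expr_sum coefXn inE eq_sym.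
by case: eqP.
Qed.

Lemma coef0_cpart_den r s n : (cpart_den r s n)`_0 = 1.
Proof.
rewrite coef0_prod big1 // => k _.
by rewrite -horner_coef0 horner_exp horner_coef0 coef0_1BXn expr1n.
Qed.

Lemma cpart_den_gf r s n : eqX n.+1 (cpart_den r s n * cpart_gf r s n) 1.
Proof.
rewrite -big_split /=; apply: eqX_prod1 => k _; rewrite -exprMn.
rewrite -[X in eqX _ _ X](expr1n _ (ncolors r s k.+1)); apply: eqX_exp.
have -> : (1 - 'X^(k.+1)) * \sum_(j < n.+1) 'X^(k.+1 * j) = 1 - 'X^(k.+1 * n.+1) :> {poly F}.
  under eq_bigr do rewrite exprM.
  by rewrite exprM -[RHS]opprB subrX1 -mulNr opprB.
by apply: eqX_1BXn; rewrite leq_pmull.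
Qed.

(** Truncations at [n] and at [M] both invert [cpart_den r s n] modulo X^(n+1): part sizes above [n]
    give denominator factors congruent to 1. *)
Lemma coef_cpart_gf r s n M : (n <= M)%N -> (cpart_gf r s M)`_n = (a r s n)%:R.
Proof.
move=> nM; rewrite -coef_cpart_gf_diag.
suff /eqXP -> : eqX n.+1 (cpart_gf r s M) (cpart_gf r s n) by [].
apply: (@eqX_cancel _ (cpart_den r s n)); first by rewrite coef0_cpart_den oner_neq0.
have/eqX_sym := cpart_den_gf r s n; apply: eqX_trans.
have nM1 : (n.+1 <= M.+1)%N by [].
apply: eqX_trans (eqX_leq nM1 (cpart_den_gf r s M)); rewrite eqXM ?eqXx //.
apply/eqX_sym/eqX_prod_nat => // k nk.
by rewrite -[X in eqX _ _ X](expr1n _ (ncolors r s k.+1)); apply/eqX_exp/eqX_1BXn.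
Qed.

End Truncation.

(** * Dissection by exponents modulo d *)

Section Dissection.
Variable R : comNzRingType.
Implicit Types p q : {poly R}.

(** The operator U_d on q-series; for d > 0 the length [size p] suffices because d * i >= i. *)
Definition psection d p : {poly R} := \poly_(i < size p) p`_(d * i).

Lemma coef_psection d p i : (0 < d)%N -> (psection d p)`_i = p`_(d * i).
Proof.
move=> d0; rewrite coef_poly; case: ltnP => // pi.
by rewrite nth_default // (leq_trans pi) // leq_pmull.
Qed.

Lemma psectionD d p q : (0 < d)%N -> psection d (p + q) = psection d p + psection d q.
Proof. by move=> d0; apply/polyP=> i; rewrite !(coefD, coef_psection). Qed.

Lemma psectionM_comp d p q : (0 < d)%N ->
  psection d (p * (q \Po 'X^d)) = psection d p * q.
Proof.
move=> d0; elim/poly_ind: q => [|q c IHq].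
  by rewrite comp_poly0 !mulr0; apply/polyP=> i; rewrite coef_psection // !coef0.
rewrite comp_polyD comp_polyM comp_polyX comp_polyC !mulrDr psectionD // !mulrA -IHq.
congr (_ + _); apply/polyP=> i.
  rewrite coef_psection // coefMXn coefMX coef_psection //.
  case: i => [|i]; first by rewrite muln0 d0.
  by rewrite mulnS ltnNge leq_addr addKn.
by rewrite coef_psection // !coefMC coef_psection.
Qed.

Lemma psection_comp d q : (0 < d)%N -> psection d (q \Po 'X^d) = q.
Proof.
move=> d0; rewrite -[_ \Po _]mul1r psectionM_comp //.
rewrite (_ : psection _ _ = 1) ?mul1r //; apply/polyP=> i.
by rewrite coef_psection // !coef1 muln_eq0 (gtn_eqF d0).
Qed.

Lemma psection_XnM_comp d k q : (0 < k < d)%N -> psection d ('X^k * (q \Po 'X^d)) = 0.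
Proof.
move=> /andP[k0 kd]; have d0 := ltn_trans k0 kd.
rewrite psectionM_comp // (_ : psection _ _ = 0) ?mul0r //; apply/polyP=> i.
rewrite coef_psection // coefXn coef0 (_ : (_ == _) = false) //.
apply/negP=> /eqP di; move: kd; rewrite -di ltnNge leq_pmulr //.
by case: i di k0 => // <-; rewrite muln0.
Qed.

Lemma theta_sum_comp_Xn d n :
  theta_sum ('X : {poly R}) n \Po 'X^d = theta_sum 'X^d n.
Proof.
rewrite /theta_sum rmorphD rmorph1 rmorph_sum; congr (_ + _).
apply: eq_bigr => t _; rewrite !rmorphM !rmorphXn /= rmorphN1 rmorph_nat.
by rewrite comp_polyX.
Qed.

(** Indices 3t give exponents 9t^2; all other squares are 1 modulo 3. The length 3n + 2 stops just
    before a multiple of 3, so the induction adds whole blocks of three terms. *)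
Lemma theta_sum_dissection n : exists g : {poly R},
  theta_sum 'X (3 * n + 2) = (theta_sum 'X n \Po 'X^9) + 'X * (g \Po 'X^3).
Proof.
rewrite theta_sum_comp_Xn; elim: n => [|n [g IHn]].
  exists (2 * 'X - 2%:P).
  rewrite /theta_sum muln0 !add0n !big_nat_recr //= !(big_geq (leqnn 0)).
  rewrite !(rmorphB, rmorphM, rmorph_nat) /= comp_polyX.
  by ring.
have thetaS q m : theta_sum q m.+1 =
    theta_sum q m + 2 * (-1) ^+ m.+1 * q ^+ (m.+1 ^ 2) :> {poly R}.
  by rewrite /theta_sum big_nat_recr //= addrA.
(* The added exponents e come from the indices 3n + 4 and 3n + 5, whose squares are 3e + 1. *)
exists (g + 2 * (-1) ^+ n * 'X^(3 * n ^ 2 + 8 * n + 5)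
          - 2 * (-1) ^+ n * 'X^(3 * n ^ 2 + 10 * n + 8)).
rewrite (_ : 3 * n.+1 + 2 = (3 * n + 2).+3)%N; last by lia.
rewrite !thetaS IHn !(rmorphB, rmorphD, rmorphM, rmorphXn, rmorph_nat, rmorphN1) /= comp_polyX.
rewrite (_ : (3 * n + 2).+1 ^ 2 = 9 * n.+1 ^ 2)%N; last by lia.
rewrite (_ : (3 * n + 2).+2 ^ 2 = 3 * (3 * n ^ 2 + 8 * n + 5) + 1)%N; last by lia.
rewrite (_ : (3 * n + 2).+3 ^ 2 = 3 * (3 * n ^ 2 + 10 * n + 8) + 1)%N; last by lia.
rewrite (exprS (-1) (3 * n + 2).+2) (exprS (-1) (3 * n + 2).+1).
have -> : (-1) ^+ (3 * n + 2).+1 = - (-1) ^+ n :> {poly R}.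
  by rewrite -signr_odd /= oddD oddM addbF /= signrN signr_odd.
rewrite (exprS (-1) n) -!exprM !(exprD _ (3 * _) 1) expr1.
by ring.
Qed.
End Dissection.

(** Frobenius: cubing is additive in characteristic 3 and fixes the elements of F_3. *)
Lemma exp3_Fp3 (p : {poly 'F_3}) : p ^+ 3 = p \Po 'X^3.
Proof.
have ch3 : [pchar {poly 'F_3}].-nat 3.
  by rewrite pnatE // pchar_poly pchar_Fp.
elim/poly_ind: p => [|p c IHp]; first by rewrite comp_poly0 expr0n.
rewrite exprDn_pchar // exprMn IHp comp_polyD comp_polyM comp_polyX comp_polyC.
congr (_ + _); rewrite -rmorphXn; congr (_%:P).
by case: c => -[|[|[|c]]] c3 //; apply: val_inj.
Qed.

(** * The partition series as the inverse square of theta *)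

Section Theta.
Variable F : fieldType.

Lemma coef0_minus_prod n : (minus_prod ('X : {poly F}) 0 n)`_0 = 1.
Proof. by rewrite coef0_prod big1 // => k _; rewrite coef0_1BXn. Qed.

Lemma coef0_plus_prod n : (plus_prod ('X : {poly F}) n)`_0 = 1.
Proof. by rewrite coef0_prod big1 // => k _; rewrite coefD coef1 coefXn addr0. Qed.

Lemma eqX_theta_sum m n : (m <= n)%N ->
  eqX m.+1 (theta_sum 'X n) (theta_sum ('X : {poly F}) m).
Proof.
move=> mn; rewrite /theta_sum (big_cat_nat (leq0n m) mn) /= /eqX.
rewrite addrA [X in _ %| X]addrAC subrr add0r big_nat_cond.
elim/big_ind: _ => [|p q|k /andP[/andP[mk _] _]]; [exact: dvdp0|exact: dvdp_add|].
rewrite dvdp_mull // dvdp_exp2l // -mulnn.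
by apply: leq_trans (leq_pmulr _ _).
Qed.

Lemma coef0_theta_sum n : (theta_sum ('X : {poly F}) n)`_0 = 1.
Proof.
have /eqXP -> // := eqX_theta_sum (leq0n n).
by rewrite /theta_sum big_geq // addr0 coef1.
Qed.

Lemma gauss_eqX n :
  eqX n.+1 (theta_sum 'X n * plus_prod 'X n) (minus_prod ('X : {poly F}) 0 n).
Proof.
rewrite gauss_finite /eqX [X in _ %| X]addrAC subrr add0r /gauss_rem.
elim/big_ind: _ => [|p q|k _]; [exact: dvdp0|exact: dvdp_add|].
by rewrite -!mulrA !(mulrCA _ 'X^_) dvdp_mulr // dvdp_exp2l // leq_pmull.
Qed.

(* Euler: prod (1 + q^k) = prod (1 - q^(2k)) / (1 - q^k). *)
Lemma cpart_den_eqX n :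
  eqX n.+1 (cpart_den F 2 4 n * plus_prod 'X n ^+ 2) (minus_prod 'X 0 n ^+ 2).
Proof.
apply: (@eqX_cancel _ _ (minus_prod 'X 0 n ^+ 2)).
  by rewrite -horner_coef0 horner_exp horner_coef0 coef0_minus_prod expr1n oner_neq0.
pose ev k : {poly F} := if odd k.+1 then 1 else 1 - 'X^(k.+1).
pose od k : {poly F} := if odd k.+1 then 1 - 'X^(k.+1) else 1.
have Ndec : minus_prod 'X 0 n = \prod_(0 <= k < n) od k * \prod_(0 <= k < n) ev k.
  rewrite -big_split /=; apply: eq_bigr => k _.
  by rewrite /od /ev; case: odd; rewrite ?mulr1 ?mul1r.
have Bdec : cpart_den F 2 4 n = (\prod_(0 <= k < n) od k) ^+ 4 * (\prod_(0 <= k < n) ev k) ^+ 2.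
  rewrite -!prodrXl -big_split /=; apply: eq_bigr => k _.
  by rewrite /od /ev /ncolors; case: (odd k.+1); rewrite expr1n ?mulr1 ?mul1r.
(* The even factors up to 2m are 1 - q^(2k) = (1 - q^k)(1 + q^k) with k <= m; for m = n, those
   beyond n are 1 modulo X^(n+1). *)
have evE m : \prod_(0 <= k < m.*2) ev k = minus_prod 'X 0 m * plus_prod 'X m.
  elim: m => [|m IHm]; first by rewrite /minus_prod /plus_prod !big_geq // mulr1.
  rewrite doubleS !big_nat_recr //= IHm minus_prod_recr // plus_prodS /ev /= odd_double /=.
  by rewrite -doubleS -addnn exprD; ring.
have ND : eqX n.+1 (minus_prod 'X 0 n * plus_prod 'X n) (\prod_(0 <= k < n) ev k).
  rewrite -evE; apply: eqX_prod_nat => [|k nk]; first by rewrite -addnn leq_addr.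
  by rewrite /ev; case: odd; [exact: eqXx | apply: eqX_1BXn].
rewrite mulrCA -exprMn Bdec.
have -> : minus_prod 'X 0 n ^+ 2 * minus_prod 'X 0 n ^+ 2 =
    (\prod_(0 <= k < n) od k) ^+ 4 * (\prod_(0 <= k < n) ev k) ^+ 2
    * (\prod_(0 <= k < n) ev k) ^+ 2 by rewrite Ndec; ring.
by apply: eqXM; [exact: eqXx | apply: eqX_exp].
Qed.

(** Gauss turns A (T P)^2 into A times the square of [minus_prod], Euler turns this into A
    [cpart_den] P^2, which is P^2; then P^2 cancels. *)
Lemma cpart_gf_theta n : eqX n.+1 (cpart_gf F 2 4 n * theta_sum 'X n ^+ 2) 1.
Proof.
apply: (@eqX_cancel _ _ (plus_prod 'X n ^+ 2)).
  by rewrite -horner_coef0 horner_exp horner_coef0 coef0_plus_prod expr1n oner_neq0.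
set A := cpart_gf _ _ _ _; set T := theta_sum _ _; set P := plus_prod _ _.
rewrite mulr1 (_ : P ^+ 2 * _ = A * (T * P) ^+ 2); last by ring.
apply: eqX_trans (eqXM (eqXx _ A) (eqX_exp 2 (gauss_eqX n))) _.
apply: eqX_trans (eqXM (eqXx _ A) (eqX_sym (cpart_den_eqX n))) _.
rewrite mulrA [A * _]mulrC -[X in eqX _ _ X]mul1r.
exact: eqXM (cpart_den_gf F 2 4 n) (eqXx _ _).
Qed.
End Theta.

(** * Extraction of the exponents 3n and 9n *)

Lemma eqX_psection (F : fieldType) d m (p q : {poly F}) : (0 < d)%N ->
  eqX (d * m) p q -> eqX m (psection d p) (psection d q).
Proof.
move=> d0 /eqXP pq; apply/eqXP=> i im.
by rewrite !coef_psection // pq // ltn_pmul2l.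
Qed.

Lemma a24_mul3 n : (a 2 4 (3 * n))%:R = (theta_sum 'X n ^+ 2 : {poly 'F_3})`_n.
Proof.
(* This length fits the dissection, and M + 1 = 3(n + 1) makes precision X^(M+1) become X^(n+1)
   under [psection 3]. *)
pose M := (3 * n + 2)%N.
set A := cpart_gf 'F_3 2 4 M; pose T : {poly 'F_3} := theta_sum 'X n.
have [g Tg] := theta_sum_dissection ('F_3) n.
rewrite -(@coef_cpart_gf _ _ _ _ M); last by rewrite leq_addr.
rewrite -coef_psection //.
suff /eqXP -> : eqX n.+1 (psection 3 A) (T ^+ 2) by [].
(* Multiplying by [T] turns T^2 into T^3 = T(q^3), which is a section of theta. *)
apply: (@eqX_cancel _ _ T); first by rewrite coef0_theta_sum oner_neq0.
rewrite -exprS exp3_Fp3 mulrC.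
have nM : (n <= M)%N by rewrite /M; lia.
apply: eqX_trans (eqXM (eqXx _ _) (eqX_sym (eqX_theta_sum _ nM))) _.
have -> : T \Po 'X^3 = psection 3 (theta_sum 'X M).
  rewrite Tg psectionD // -['X]expr1 psection_XnM_comp // addr0.
  rewrite -(psection_comp (T \Po 'X^3) (isT : 0 < 3)%N).
  by rewrite -comp_polyA comp_Xn_poly -exprM.
(* Inside the section the theta factor becomes theta(q^3) = theta^3, and A theta^2 = 1 leaves
   theta. *)
rewrite -psectionM_comp // -exp3_Fp3; apply: eqX_psection => //.
rewrite (_ : 3 * n.+1 = M.+1)%N; last by rewrite /M; lia.
rewrite exprSr mulrA -[X in eqX _ _ X]mul1r.
by apply: eqXM; [exact: cpart_gf_theta | exact: eqXx].
Qed.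

Lemma theta_sqr_mul9 (F : fieldType) n :
  (theta_sum 'X (9 * n) ^+ 2 : {poly F})`_(9 * n) = (theta_sum 'X n ^+ 2)`_n.
Proof.
pose S : {poly F} := theta_sum 'X (3 * n).
have [g Tg] := theta_sum_dissection F (3 * n).
have nM : (9 * n <= 3 * (3 * n) + 2)%N by lia.
have /eqXP <- // := eqX_exp 2 (eqX_theta_sum F nM).
(* The summands collect the exponents 0, 1, 2 modulo 3; only the first, where x and y are both
   divisible by 3, reaches 9n. *)
have sqrE : theta_sum 'X (3 * (3 * n) + 2) ^+ 2 =
    (((S ^+ 2) \Po 'X^3) \Po 'X^3) + 'X^1 * ((2 * (S \Po 'X^3) * g) \Po 'X^3)
    + 'X^2 * ((g ^+ 2) \Po 'X^3).
  rewrite Tg (_ : S \Po 'X^9 = (S \Po 'X^3) \Po 'X^3); last first.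
    by rewrite -comp_polyA comp_Xn_poly -exprM.
  by rewrite !(rmorphM, rmorphXn, rmorph_nat) /=; ring.
rewrite (_ : 9 * n = 3 * (3 * n))%N; last by lia.
rewrite -coef_psection // sqrE !psectionD // !psection_XnM_comp // !addr0.
rewrite psection_comp // coef_comp_poly_Xn // dvdn_mulr // mulKn //.
have nM' : (n <= 3 * n)%N by rewrite leq_pmull.
by have /eqXP -> := eqX_exp 2 (eqX_theta_sum F nM').
Qed.

Theorem theorem1p8 (n : nat) : a 2 4 (27 * n) = a 2 4 (3 * n) %[mod 3].
Proof.
suff E : (a 2 4 (27 * n))%:R = (a 2 4 (3 * n))%:R :> 'F_3.
  by have := congr1 val E; rewrite /= !val_Fp_nat.
rewrite (_ : 27 * n = 3 * (9 * n))%N; last by lia.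
by rewrite !a24_mul3 theta_sqr_mul9.
Qed.
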